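(* Let $K$ be an infinite field, $R = K[x_1,\ldots,x_n]$, and let $I \subseteq R$ be a homogeneous ideal such that the modules $a_{\mathbf{x}}^i(I)$ have finite length for all $i \in \{1,\ldots,n\}$. Let $<$ be the reverse lexicographic order on $R$ with $x_1 > x_2 > \cdots > x_n$, and let $\mathrm{in}_<(I)$ be the initial ideal of $I$. Then $\alpha_{ij}(R/I) = \alpha_{ij}(R/\mathrm{in}_<(I))$ for all $i,j$.
   Context: $R$ carries the standard grading, and $R_1$ is its degree-one component. For a homogeneous ideal $I \subseteq R$ put $I_0 = I$ and $I_i = I_{i-1} + (x_{n-i+1})$ for $i \in \{1,\ldots,n\}$, and define, with respect to the sequence $\mathbf{x} = x_n, x_{n-1}, \ldots, x_1$, $$a_{\mathbf{x}}^i(I) = \frac{I_{i-1} : (x_{n-i+1})}{I_{i-1}}, \qquad i = 1,\ldots,n.$$ For a finitely generated graded $R$-module $M$ and a sequence $\mathbf{y} = y_1,\ldots,y_n$ of elements of $R_1$, let $A_{i-1}(\mathbf{y};M)$ be the graded $R$-module $\left( 0 :_{M/(y_1,\ldots,y_{i-1})M} y_i \right)$, for $i = 1,\ldots,n$. The annihilator numbers of $M$ with respect to $\mathbf{y}$ are $\alpha_{ij}(\mathbf{y};M) = \dim_K A_i(\mathbf{y};M)_j$, for $i = 0,\ldots,n-1$ and all degrees $j$. One writes $\alpha_{ij}(R/I)$ for $\alpha_{ij}(x_n,x_{n-1},\ldots,x_1;R/I)$, and likewise for $\mathrm{in}_<(I)$ in place of $I$. *)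

(* Defs.v *)
From HB Require Import structures.
From mathcomp Require Import all_boot all_order all_algebra.
From mathcomp Require Import generic_quotient ring_quotient.
From mathcomp Require Import mpoly.
From mathcomp Require Import boolp classical_sets functions cardinality.

Set Implicit Arguments.
Unset Strict Implicit.
Unset Printing Implicit Defensive.

Import GRing.Theory.
Local Open Scope ring_scope.
Local Open Scope quotient_scope.
Local Open Scope classical_set_scope.

(* GRing's submodClosed is not known to be closed under opposite, hence cannot
   be fed to {quot _}; ring_quotient's idealr excludes the unit ideal. *)
Record submodule (R : nzRingType) (V : lmodType R) := Submodule {
  submod_pred :> {pred V};
  submod_predP : submod_closed submod_pred }.

Notation ideal R := (submodule R^o).

Section Submodules.
Variables (R : nzRingType) (V : lmodType R).
Implicit Types N : submodule V.

HB.instance Definition _ N :=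
  GRing.isSubmodClosed.Build R V (submod_pred N) (submod_predP N).

Definition span_pred (S : set V) : {pred V} := fun v =>
  `[< exists s : seq (R * V),
        (forall p, p \in s -> S p.2) /\ v = \sum_(p <- s) p.1 *: p.2 >].

Lemma span_closed S : submod_closed (span_pred S).
Proof.
split=> [|a u v]; first by apply/asboolP; exists [::]; rewrite big_nil.
move=> /asboolP[s [Ss ->]] /asboolP[t [St ->]]; apply/asboolP.
exists ([seq (a * p.1, p.2) | p <- s] ++ t); split=> [p|].
  by rewrite mem_cat => /orP[/mapP[q /Ss Sq ->]|/St].
rewrite big_cat big_map scaler_sumr; congr (_ + _).
by apply: eq_bigr => p _; rewrite scalerA.
Qed.

Definition span S : submodule V := Submodule (span_closed S).

Definition add_pred N1 N2 : {pred V} := fun v =>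
  `[< exists u w, [/\ u \in N1, w \in N2 & v = u + w] >].

Lemma add_closed N1 N2 : submod_closed (add_pred N1 N2).
Proof.
split=> [|a _ _ /asboolP[u [w [Nu Nw ->]]] /asboolP[u' [w' [Nu' Nw' ->]]]].
  by apply/asboolP; exists 0, 0; rewrite !rpred0 addr0.
apply/asboolP; exists (a *: u + u'), (a *: w + w').
by rewrite !rpredD ?rpredZ // scalerDr addrACA.
Qed.

Definition submod_add N1 N2 : submodule V := Submodule (add_closed N1 N2).

(* The lengths of the strict chains of submodules of N are bounded. *)
Definition finite_length N : Prop :=
  exists b : nat, forall (l : nat) (c : nat -> submodule V),
    (forall k, (k <= l)%N -> {subset c k <= N}) ->
    (forall k, (k < l)%N ->
       {subset c k <= c k.+1} /\ (exists2 v, v \in c k.+1 & v \notin c k)) ->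
    (l <= b)%N.

End Submodules.

Section QuotientModule.
Variables (R : nzRingType) (V : lmodType R) (N : submodule V).

Definition quotmod := Quotient.quot (submod_pred N : zmodClosed V).

HB.instance Definition _ := GRing.Zmodule.on quotmod.
HB.instance Definition _ := Quotient.on quotmod.

Definition quotmod_scale (a : R) (q : quotmod) : quotmod :=
  \pi_quotmod (a *: repr q).

Lemma pi_quotmodE (x y : V) :
  (\pi_quotmod x == \pi_quotmod y) = (x - y \in N).
Proof. by rewrite Quotient.idealrBE. Qed.

Lemma pi_quotmodD (x y : V) :
  \pi_quotmod (x + y) = \pi_quotmod x + \pi_quotmod y.
Proof. by rewrite !piE. Qed.

Lemma quotmod_scaleE a x :
  quotmod_scale a (\pi_quotmod x) = \pi_quotmod (a *: x).
Proof.
apply/eqP; rewrite /quotmod_scale pi_quotmodE -scalerBr rpredZ //.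
by rewrite -pi_quotmodE reprK.
Qed.

Lemma quotmod_scaleA a b q :
  quotmod_scale a (quotmod_scale b q) = quotmod_scale (a * b) q.
Proof. by elim/(@quotW _ quotmod): q => x; rewrite !quotmod_scaleE scalerA. Qed.

Lemma quotmod_scale1 : left_id 1 quotmod_scale.
Proof. by elim/(@quotW _ quotmod)=> x; rewrite quotmod_scaleE scale1r. Qed.

Lemma quotmod_scaleDr : right_distributive quotmod_scale +%R.
Proof.
move=> a; elim/(@quotW _ quotmod)=> x; elim/(@quotW _ quotmod)=> y.
by rewrite -pi_quotmodD !quotmod_scaleE scalerDr pi_quotmodD.
Qed.

Lemma quotmod_scaleDl q : {morph quotmod_scale^~ q : a b / a + b}.
Proof.
elim/(@quotW _ quotmod): q => x a b.
by rewrite !quotmod_scaleE scalerDl pi_quotmodD.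
Qed.

HB.instance Definition _ := GRing.Zmodule_isLmodule.Build R quotmod
  quotmod_scaleA quotmod_scale1 quotmod_scaleDr quotmod_scaleDl.

Lemma pi_quotmodZ a (x : V) : \pi_quotmod (a *: x) = a *: \pi_quotmod x.
Proof. by rewrite -quotmod_scaleE. Qed.

Definition quot_image (S : set V) : set quotmod :=
  [set q | exists2 v, S v & q = \pi_quotmod v].

Definition quot_submod_pred (P : submodule V) : {pred quotmod} := fun q =>
  `[< quot_image [set v | v \in P] q >].

Lemma quot_submod_closed P : submod_closed (quot_submod_pred P).
Proof.
split=> [|a _ _ /asboolP[u Pu ->] /asboolP[v Pv ->]]; apply/asboolP.
  by exists 0; [exact: (rpred0 P) | rewrite !piE].
exists (a *: u + v); first by rewrite /= rpredD // rpredZ.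
by rewrite pi_quotmodD pi_quotmodZ.
Qed.

(* The submodule (P + N) / N of V / N; it is P / N when P contains N. *)
Definition quot_submod (P : submodule V) : submodule quotmod :=
  Submodule (quot_submod_closed P).

End QuotientModule.

Arguments quot_image {R V} N S _.

Notation "V '/m' N" := (@quotmod _ V N) (at level 40, no associativity).

Section Annihilators.
Variables (R : comNzRingType) (V : lmodType R).

Definition annih_pred (a : R) : {pred V} := fun v => a *: v == 0.

Lemma annih_closed a : submod_closed (annih_pred a).
Proof.
split=> [|b u v /eqP au0 /eqP av0]; apply/eqP; first exact: scaler0.
by rewrite scalerDr scalerA mulrC -scalerA au0 av0 scaler0 addr0.
Qed.

Definition annih a : submodule V := Submodule (annih_closed a).

Definition colon_pred (N : submodule V) (a : R) : {pred V} :=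
  fun v => a *: v \in N.

Lemma colon_closed N a : submod_closed (colon_pred N a).
Proof.
have colonE v : (v \in colon_pred N a) = (a *: v \in N) by [].
split=> [|b u v]; rewrite !colonE; first by rewrite scaler0 rpred0.
move=> Nau Nav; rewrite scalerDr scalerA mulrC -scalerA.
by rewrite rpredD // rpredZ.
Qed.

Definition colon (N : submodule V) a : submodule V :=
  Submodule (colon_closed N a).

End Annihilators.

Section AnnihilatorNumbers.
Variables (K : fieldType) (n : nat).
Local Notation R := {mpoly K[n]}.

Definition has_dim (M : lmodType R) (S : set M) (d : nat) : Prop :=
  exists b : 'I_d -> M,
  [/\ forall k, S (b k),
      forall c : 'I_d -> K,
        \sum_k (c k)%:MP *: b k = 0 -> forall k, c k = 0
    & forall v, S v -> exists c : 'I_d -> K, v = \sum_k (c k)%:MP *: b k].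

(* The dimension of the K-subspace S of M. The default value 0 for infinite
   dimension is not reached on the homogeneous components of a subquotient of
   a finitely generated graded module. *)
Definition dimK (M : lmodType R) (S : set M) : nat :=
  xget 0%N [set d | has_dim S d].

Section Module.
Variables (M : lmodType R) (M_ : int -> set M) (y : n.-tuple R).

Definition init_submod (i : 'I_n) : submodule M :=
  span [set v | exists2 k : 'I_n, (k < i)%N & exists m, v = tnth y k *: m].

(* Indices are shifted: tnth y i is y_(i+1), so that this is A_i(y; M). *)
Definition annih_mod (i : 'I_n) : submodule (M /m init_submod i) :=
  annih _ (tnth y i).

(* M_ is the grading of M; quotients carry the image grading and submodules
   the induced one. *)
Definition alpha (i : 'I_n) (j : int) : nat :=
  dimK ([set q | q \in annih_mod i] `&` quot_image (init_submod i) (M_ j)).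

End Module.

Definition std_grading (j : int) : set R^o :=
  if j is Posz d then [set p | (p : R) \is d.-homog] else [set 0].

(* The sequence x_n, ..., x_1, where x_(k+1) is 'X_k. *)
Definition revvars : n.-tuple R := [tuple 'X_(rev_ord i) | i < n].

Definition alpha_quot (I : ideal R) (i : 'I_n) (j : int) : nat :=
  @alpha (R^o /m I) (fun d => quot_image I (std_grading d)) revvars i j.

Definition homogeneous_ideal (I : ideal R) : Prop :=
  forall (p : R) (d : nat), p \in I -> pihomog mdeg d p \in I.

(* Only the values for i <= n are meaningful. *)
Fixpoint add_vars (I : ideal R) (i : nat) : ideal R :=
  if i is k.+1 then submod_add (add_vars I k) (span [set revvars`_k : R^o])
  else I.

(* The module a_x^(i+1)(I). *)
Definition a_mod (I : ideal R) (i : 'I_n) : submodule (R^o /m add_vars I i) :=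
  quot_submod _ (colon (add_vars I i) (tnth revvars i)).

(* Despite its documentation, the order of 'X_{1..n} in mpoly is the degree
   lexicographic one, so neither it nor mlead can be used here. *)
Definition revlex_lt (m1 m2 : 'X_{1..n}) : bool :=
  (mdeg m1 < mdeg m2)%N ||
  (mdeg m1 == mdeg m2) &&
  [exists i : 'I_n, (m2 i < m1 i)%N &&
     [forall j : 'I_n, (i < j)%N ==> (m1 j == m2 j)]].

Definition initial_monomial (p : R) (m : 'X_{1..n}) : Prop :=
  m \in msupp p /\ {in msupp p, forall m', m' != m -> revlex_lt m' m}.

Definition initial_ideal (I : ideal R) : ideal R :=
  @span R R^o [set 'X_[m] | m in
    [set m | exists2 p : R, p \in I & initial_monomial p m]].

End AnnihilatorNumbers.

(* Main.v *)
From HB Require Import structures.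
Require Import Defs.
From mathcomp Require Import all_boot all_order all_algebra.
From mathcomp Require Import generic_quotient mpoly.
From mathcomp Require Import boolp classical_sets functions cardinality.

(* Write J = I + (x_n, ..., x_(r+1)). A reverse lexicographic initial monomial
   that avoids x_n, ..., x_(r+1) is not affected by homogeneous terms in these
   variables, hence in(J) = in(I) + (x_n, ..., x_(r+1)) and
   in(J : x_r) = in(J) : x_r. As the dimension of a quotient of subspaces of
   R_j is the number of initial monomials gained, the dimension of
   ((J : x_r) / J)_j is the number of monomials m of degree j with m not in
   in(J) but x_r m in in(J), which depends on in(I) only. *)

Set Implicit Arguments.
Unset Strict Implicit.
Unset Printing Implicit Defensive.

Import GRing.Theory.
Local Open Scope ring_scope.
Local Open Scope quotient_scope.
Local Open Scope classical_set_scope.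

(** * The reverse lexicographic order on monomials *)

Section RevLex.
Variable n : nat.
Implicit Types (m : 'X_{1..n}) (r : 'I_n).

Lemma revlex_ltP m1 m2 : mdeg m1 = mdeg m2 ->
  reflect (exists2 i : 'I_n, (m2 i < m1 i)%N &
             forall j : 'I_n, (i < j)%N -> m1 j = m2 j)
          (revlex_lt m1 m2).
Proof.
move=> eq_deg; rewrite /revlex_lt eq_deg ltnn eqxx /=.
apply: (iffP existsP) => [[i /andP[lt_i /forallP eq_i]]|[i lt_i eq_i]];
  exists i.
- by [].
- by move=> j lt_ij; apply/eqP; move: (eq_i j); rewrite lt_ij.
- by rewrite lt_i; apply/forallP => j; apply/implyP => /eq_i ->.
Qed.

Lemma revlex_lt_mdeg m1 m2 : revlex_lt m1 m2 -> (mdeg m1 <= mdeg m2)%N.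
Proof. by case/orP=> [/ltnW|/andP[/eqP->]]. Qed.

Lemma revlex_lt_irr : irreflexive (@revlex_lt n).
Proof. by move=> m; apply/negP => /revlex_ltP[//|i]; rewrite ltnn. Qed.

Lemma revlex_lt_trans : transitive (@revlex_lt n).
Proof.
move=> m2 m1 m3 lt12 lt23.
have [lt_deg|] := ltnP (mdeg m1) (mdeg m3); first by rewrite /revlex_lt lt_deg.
move=> le31; have le12 := revlex_lt_mdeg lt12; have le23 := revlex_lt_mdeg lt23.
have e12 : mdeg m1 = mdeg m2.
  by apply/eqP; rewrite eqn_leq le12 (leq_trans le23).
have e23 : mdeg m2 = mdeg m3.
  by apply/eqP; rewrite eqn_leq le23 -e12.
have /(revlex_ltP e12)[i lt_i eq_i] := lt12.
have /(revlex_ltP e23)[j lt_j eq_j] := lt23.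
apply/(revlex_ltP (etrans e12 e23)).
(* The larger of the two deciding indices decides the composite comparison. *)
have [lt_ij|lt_ji|/val_inj eq_ij] := ltngtP i j.
- exists j; first by rewrite (eq_i _ lt_ij).
  by move=> k lt_jk; rewrite -eq_j // eq_i // (ltn_trans lt_ij).
- exists i; first by rewrite -(eq_j _ lt_ji).
  by move=> k lt_ik; rewrite -eq_j ?eq_i // (ltn_trans lt_ji).
- exists i; first by rewrite (ltn_trans _ lt_i) // eq_ij.
  by move=> k lt_ik; rewrite eq_i // eq_j // -eq_ij.
Qed.

Lemma revlex_lt_total m1 m2 : m1 != m2 -> revlex_lt m1 m2 || revlex_lt m2 m1.
Proof.
move=> neq12.
have [lt_deg|lt_deg|eq_deg] := ltngtP (mdeg m1) (mdeg m2).
- by rewrite /revlex_lt lt_deg.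
- by apply/orP; right; rewrite /revlex_lt lt_deg.
have [i0 neq_i0] : exists i, m1 i != m2 i.
  apply/existsP; apply: contraNT neq12 => /existsPn eq12.
  by apply/eqP/mnmP => i; apply/eqP; have := eq12 i; rewrite negbK.
(* The largest index at which the exponents differ decides the comparison. *)
case: (@arg_maxnP _ i0 (fun i => m1 i != m2 i) (@nat_of_ord n) neq_i0)
  => i neq_i max_i.
have eq_i (j : 'I_n) : (i < j)%N -> m1 j = m2 j.
  move=> lt_ij; apply/eqP; apply: contraTT lt_ij => /max_i.
  by rewrite -leqNgt.
have [lt_i|lt_i|eq_mi] := ltngtP (m1 i) (m2 i).
- apply/orP; right; apply/revlex_ltP; first by rewrite eq_deg.
  by exists i => // j /eq_i.
- by apply/orP; left; apply/revlex_ltP => //; exists i => // j /eq_i.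
- by rewrite eq_mi eqxx in neq_i.
Qed.

Lemma revlex_lt_add2l m m1 m2 :
  revlex_lt (m + m1)%MM (m + m2)%MM = revlex_lt m1 m2.
Proof.
rewrite /revlex_lt !mdegD ltn_add2l eqn_add2l; congr (_ || _ && _).
apply: eq_existsb => i; rewrite !mnmDE ltn_add2l; congr andb.
by apply: eq_forallb => j; rewrite !mnmDE eqn_add2l.
Qed.

Lemma revlex_max_seq (s : seq 'X_{1..n}) : s != [::] ->
  exists2 m, m \in s & {in s, forall m', m' != m -> revlex_lt m' m}.
Proof.
elim: s => // m [|m0 s] IHs _.
  by exists m; rewrite ?mem_head // => m'; rewrite inE => ->.
have [//|M Ms maxM] := IHs.
have [eqM|neqM] := eqVneq m M.
  exists M => [|m']; rewrite inE ?Ms ?orbT // eqM.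
  by case/predU1P=> [->|/maxM//]; rewrite eqxx.
have /orP[ltmM|ltMm] := revlex_lt_total neqM.
  exists M => [|m']; rewrite inE ?Ms ?orbT //.
  by case/predU1P=> [->//|/maxM].
exists m => [|m']; first exact: mem_head.
rewrite inE => /predU1P[->|ms' _]; first by rewrite eqxx.
have [->//|/(maxM _ ms') lt'] := eqVneq m' M.
exact: revlex_lt_trans lt' ltMm.
Qed.

(** For [r = rev_ord i], the variables beyond [r] are the first [i] entries of [revvars], so these
    are the monomials of the ideal generated by those entries. *)
Definition has_later_var r m := [exists l : 'I_n, (r < l)%N && (0 < m l)%N].

Lemma has_later_varP r m :
  reflect (exists2 l : 'I_n, (r < l)%N & (0 < m l)%N) (has_later_var r m).
Proof.
apply: (iffP existsP) => [[l /andP[]]|[l rl ml]]; exists l => //.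
exact/andP.
Qed.

Lemma has_later_varDl r m m' :
  has_later_var r m -> has_later_var r (m + m')%MM.
Proof.
case/has_later_varP=> l rl ml; apply/has_later_varP; exists l => //.
by rewrite mnmDE addn_gt0 ml.
Qed.

Lemma has_later_varD1 r m :
  has_later_var r (U_(r) + m)%MM = has_later_var r m.
Proof.
apply/idP/idP => [/has_later_varP[l rl ml]|/has_later_varDl]; last first.
  by rewrite addmC; apply.
apply/has_later_varP; exists l => //; move: ml.
by rewrite mnmDE mnm1E (negbTE (_ : r != l)) // -val_eqE /= neq_ltn rl.
Qed.

(* The property that singles out the reverse lexicographic order. *)
Lemma later_var_revlex_lt r m1 m2 : mdeg m1 = mdeg m2 ->
  has_later_var r m1 -> ~~ has_later_var r m2 -> revlex_lt m1 m2.
Proof.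
move=> eq_deg /existsP[l0 l0P] /existsPn nm2.
case: (@arg_maxnP _ l0 (fun l => (r < l)%N && (0 < m1 l)%N) (@nat_of_ord n) l0P)
  => l /andP[rl ml] max_l.
have m2_0 (k : 'I_n) : (r < k)%N -> m2 k = 0%N.
  by move=> rk; have := nm2 k; rewrite rk /= lt0n negbK => /eqP.
apply/revlex_ltP => //; exists l => [|k lk]; first by rewrite m2_0.
have rk := ltn_trans rl lk; rewrite m2_0 //; apply/eqP; rewrite -leqn0 leqNgt.
by apply: contraL lk => mk; rewrite -leqNgt; apply: max_l; rewrite rk.
Qed.

(** All exponents beyond [r] vanish, so the deciding index is at most [r]: if it is [r] the
    inequality is strict, if it is smaller the exponents at [r] agree. *)
Lemma revlex_le_var r m1 m2 : mdeg m1 = mdeg m2 ->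
  ~~ has_later_var r m1 -> ~~ has_later_var r m2 ->
  revlex_lt m1 m2 -> (m2 r <= m1 r)%N.
Proof.
move=> eq_deg /existsPn nm1 /existsPn nm2 /(revlex_ltP eq_deg)[i lt_i eq_i].
have [ri|ir|/val_inj ->] := ltngtP r i; last exact: ltnW.
  by have := nm1 i; rewrite ri /= (leq_ltn_trans _ lt_i).
by rewrite eq_i.
Qed.

End RevLex.

(** * Initial monomials of polynomials and of their homogeneous components *)

Section InitialMonomial.
Variables (K : fieldType) (n : nat).
Local Notation R := {mpoly K[n]}.
Implicit Types (p q : R) (m : 'X_{1..n}).

Lemma initial_monomial_ex p : p != 0 -> exists m, initial_monomial p m.
Proof.
move=> p0; have [|m mp max_m] := @revlex_max_seq n (msupp p).
  by rewrite msupp_eq0.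
by exists m.
Qed.

Lemma initial_monomialX m : initial_monomial ('X_[m] : R) m.
Proof.
by split=> [|m']; rewrite msuppX mem_seq1 // => /eqP ->; rewrite eqxx.
Qed.

Lemma initial_monomialMX p m m' :
  initial_monomial p m -> initial_monomial (p * 'X_[m']) (m' + m)%MM.
Proof.
have suppE k :
    (k \in msupp (p * 'X_[m'])) = (k \in [seq (m' + i)%MM | i <- msupp p]).
  exact: perm_mem (msuppMX p m') k.
case=> mp max_m; split=> [|k]; rewrite suppE; first exact: map_f.
case/mapP=> i ip ->; rewrite revlex_lt_add2l => neq; apply: max_m => //.
by apply: contraNneq neq => ->.
Qed.

Lemma mcoeff_pihomog d p m : (pihomog mdeg d p)@_m = p@_m *+ (mdeg m == d).
Proof.
have [eq_m|neq_m] := eqVneq (mdeg m) d; last first.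
  exact: (dhomog_nemf_coeff (pihomogP mdeg d p) neq_m).
rewrite mulr1n pihomogE raddf_sum [in RHS](mpolyE p) raddf_sum /= big_mkcond.
apply: eq_bigr => i _; case: eqVneq => // neq_i; rewrite mcoeffZ mcoeffX.
by case: eqVneq => [eq_i|_]; rewrite ?mulr0 //; rewrite eq_i eq_m eqxx in neq_i.
Qed.

Lemma initial_monomial_pihomog p m :
  initial_monomial p m -> initial_monomial (pihomog mdeg (mdeg m) p) m.
Proof.
case=> mp max_m; split.
  by rewrite mcoeff_msupp mcoeff_pihomog eqxx -mcoeff_msupp.
move=> k; rewrite mcoeff_msupp mcoeff_pihomog => k_p; apply: max_m.
by apply: contraNT k_p => /memN_msupp_eq0 ->; rewrite mul0rn.
Qed.

End InitialMonomial.

(** * Dimensions counted by initial monomials *)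

Section Dimension.
Variables (K : fieldType) (n : nat).
Local Notation R := {mpoly K[n]}.
Implicit Types (p q : R) (m : 'X_{1..n}).

(** Expanding the first basis in the second and back gives matrices with product the identity of
    size [d], since the first basis is free; this forces [d <= e]. *)
Lemma has_dim_le (M : lmodType R) (S : set M) d e :
  has_dim S d -> has_dim S e -> (d <= e)%N.
Proof.
move=> [b [Sb b_free b_span]] [b' [Sb' _ b'_span]].
have /choice[A bE] := fun k => b'_span _ (Sb k).
have /choice[B b'E] := fun l => b_span _ (Sb' l).
suff AB1 : (\matrix_(k, l) A k l) *m (\matrix_(l, k) B l k) = 1%:M.
  exact: mulmx1_min AB1.
apply/matrixP => k j; rewrite !mxE.
have : \sum_j (\sum_l A k l * B l j - (k == j)%:R)%:MP *: b j = 0.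
  have deltaE : \sum_i ((k == i)%:R)%:MP *: b i = b k.
    rewrite (bigD1 k) //= eqxx mpolyC1 scale1r big1 ?addr0 // => i ik.
    by rewrite eq_sym (negbTE ik) mpolyC0 scale0r.
  under eq_bigr do rewrite mpolyCB scalerBl rmorph_sum scaler_suml.
  rewrite sumrB exchange_big /= deltaE.
  apply/eqP; rewrite subr_eq0; apply/eqP; rewrite [RHS]bE.
  apply: eq_bigr => l _; rewrite b'E scaler_sumr; apply: eq_bigr => i _.
  by rewrite scalerA mpolyCM.
move/b_free => /(_ j) /eqP; rewrite subr_eq0 => /eqP <-.
by apply: eq_bigr => l _; rewrite !mxE.
Qed.

Lemma dimKE (M : lmodType R) (S : set M) d : has_dim S d -> dimK S = d.
Proof.
move=> Sd; apply: xget_unique => // e Se; apply/eqP.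
by rewrite eqn_leq (has_dim_le Sd Se) (has_dim_le Se Sd).
Qed.

(** One step of the division algorithm: the coefficients at [m] cancel, and every other monomial of
    either support is already below [m]. *)
Lemma initial_monomial_cancel p q m :
  initial_monomial p m -> initial_monomial q m ->
  {in msupp (p - (p@_m / q@_m) *: q), forall m', revlex_lt m' m}.
Proof.
move=> [mp max_p] [mq max_q] m' m'_pq.
have neq : m' != m.
  apply: contraTneq m'_pq => ->; rewrite mcoeff_msupp mcoeffB mcoeffZ.
  by rewrite divfK ?subrr ?eqxx // -mcoeff_msupp.
have := msuppB_le m'_pq; rewrite mem_cat.
by case/orP=> [/max_p|/msuppZ_le/max_q]; apply.
Qed.

(** The largest of the initial monomials with nonzero coefficient occurs in only one summand, so it
    cannot cancel. This yields linear independence. *)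
Lemma initial_monomial_sum l (ms : l.-tuple 'X_{1..n})
    (b : 'I_l -> R) (c : 'I_l -> K) :
  uniq ms -> (forall k, initial_monomial (b k) (tnth ms k)) ->
  (exists k, c k != 0) ->
  exists2 m, m \in ms & initial_monomial (\sum_k c k *: b k) m.
Proof.
move=> ms_uniq in_b [k0 ck0].
pose s := [seq tnth ms k | k <- enum 'I_l & c k != 0].
have memsP k : c k != 0 -> tnth ms k \in s.
  by move=> ck; apply: map_f; rewrite mem_filter ck mem_enum.
have [|m sm max_m] := @revlex_max_seq n s.
  by apply/eqP => s0; have := memsP _ ck0; rewrite s0.
have /mapP[k1] := sm; rewrite mem_filter => /andP[ck1 _] m_k1.
have lt_m k m' : c k != 0 -> m' \in msupp (b k) -> m' != m -> revlex_lt m' m.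
  move=> ck m'b neq; have [_ max_b] := in_b k.
  have [eqk|neqk] := eqVneq (tnth ms k) m.
    by rewrite -eqk; apply: max_b => //; rewrite eqk.
  have lt_km := max_m _ (memsP _ ck) neqk.
  have [->//|/(max_b _ m'b) lt'] := eqVneq m' (tnth ms k).
  exact: revlex_lt_trans lt' lt_km.
exists m; first by rewrite m_k1 mem_tnth.
split=> [|m'].
  rewrite mcoeff_msupp raddf_sum (bigD1 k1) //= big1 => [|k neq_k].
    rewrite addr0 mcoeffZ mulf_neq0 // -mcoeff_msupp m_k1.
    by case: (in_b k1).
  (* If [m] occurred in another [b k], it would be below the initial monomial of [b k], which is
     itself below [m]. *)
  rewrite mcoeffZ; have [->|ck] := eqVneq (c k) 0; first exact: mul0r.
  rewrite memN_msupp_eq0 ?mulr0 //; apply/negP => mb.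
  have neqm : tnth ms k != m.
    rewrite m_k1; apply: contra neq_k => /eqP/(congr1 (index^~ ms)).
    by rewrite !(tnth_nth m) !index_uniq ?size_tuple // => /val_inj ->.
  have lt_km := max_m _ (memsP _ ck) neqm.
  have [_ /(_ _ mb)] := in_b k; rewrite eq_sym => /(_ neqm) lt_mk.
  by have := revlex_lt_trans lt_mk lt_km; rewrite revlex_lt_irr.
move=> /msupp_sum_le/flattenP[_ /mapP[k _ ->] m'b].
have [ck0'|ck] := eqVneq (c k) 0; first by rewrite ck0' scale0r msupp0 in m'b.
by apply: (lt_m k) => //; apply: msuppZ_le m'b.
Qed.

(* Initial monomials of the part of degree d of the preimage of N that are not
   initial monomials of the kernel index a basis of the image. *)
Lemma has_dim_initial (M : lmodType R) (phi : {linear R^o -> M})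
    (N : submodule M) d (ms : seq 'X_{1..n}) :
  uniq ms ->
  (forall p m, p \is d.-homog -> phi p = 0 -> initial_monomial p m ->
     m \notin ms) ->
  (forall p m, p \is d.-homog -> phi p \in N -> initial_monomial p m ->
     m \in ms \/
     exists q, [/\ q \is d.-homog, phi q = 0 & initial_monomial q m]) ->
  (forall m, m \in ms ->
     exists p, [/\ p \is d.-homog, phi p \in N & initial_monomial p m]) ->
  has_dim ([set v | v \in N] `&` phi @` [set p : R | p \is d.-homog]) (size ms).
Proof.
move=> ms_uniq ker_ms pre_ms ms_pre.
have phiZ (c : K) p : phi (c *: p) = c%:MP *: phi p.
  by rewrite -linearZ /= -mul_mpolyC.
have /choice[B BP] : forall m, exists p, m \in ms ->
    [/\ p \is d.-homog, phi p \in N & initial_monomial p m].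
  move=> m; have [/ms_pre[p pP]|_] := boolP (m \in ms); first by exists p.
  by exists 0.
pose t := in_tuple ms.
have tP k : tnth t k \in ms by exact: mem_tnth.
pose b k := B (tnth t k).
exists (fun k => phi (b k)); split.
- move=> k; have [homB NB _] := BP _ (tP k).
  by split=> //=; exists (b k).
- move=> c; under eq_bigr do rewrite -phiZ.
  rewrite -raddf_sum => sum0 k; apply/eqP; apply/negPn/negP => ck.
  have in_b l : initial_monomial (b l) (tnth t l) by have [] := BP _ (tP l).
  have [//||m mt in_m] := @initial_monomial_sum _ t b c _ in_b.
    by exists k.
  suff hom_sum : \sum_l c l *: b l \is d.-homog.
    by have := ker_ms _ _ hom_sum sum0 in_m; rewrite mt.
  by apply: rpred_sum => l _; apply: rpredZ; have [] := BP _ (tP l).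
(* The rank of [m] among the finitely many monomials of degree at most [d] turns descent along the
   order into induction on a natural number. *)
pose rk m := #|[pred x : 'X_{1..n < d.+1} | revlex_lt (x : 'X_{1..n}) m]|.
have rk_lt m m' : mdeg m' = d -> revlex_lt m' m -> (rk m' < rk m)%N.
  move=> deg_m' lt_m'; apply: proper_card; apply/properP; split.
    by apply/fintype.subsetP => x; rewrite !inE => /revlex_lt_trans; apply.
  have deg_lt : (mdeg m' < d.+1)%N by rewrite deg_m'.
  by exists (BMultinom deg_lt); rewrite !inE //= revlex_lt_irr.
suff span_lt k p : p \is d.-homog -> phi p \in N ->
    {in msupp p, forall m, (rk m < k)%N} ->
    exists c : 'I_(size ms) -> K, phi p = \sum_l (c l)%:MP *: phi (b l).
  move=> v [/= Nv [p homp pv]]; rewrite -pv in Nv *.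
  apply: (span_lt #|{: ('X_{1..n < d.+1})}|.+1) => // m _.
  by rewrite ltnS max_card.
elim: k p => [|k IHk] p homp Np rk_p.
  exists (fun=> 0); rewrite big1 => [|l _]; last by rewrite mpolyC0 scale0r.
  suff -> : p = 0 by rewrite raddf0.
  apply/eqP; apply: contraT => /initial_monomial_ex[m [/rk_p]].
  by rewrite ltn0.
have [->|/initial_monomial_ex[m in_m]] := eqVneq p 0.
  exists (fun=> 0); rewrite big1 => [|l _]; first by rewrite raddf0.
  by rewrite mpolyC0 scale0r.
(* Cancelling the initial term of [p] against any admissible [q] with the same initial monomial
   lowers the rank, so the induction hypothesis applies to the remainder. *)
have reduce q : q \is d.-homog -> phi q \in N -> initial_monomial q m ->
    exists c : 'I_(size ms) -> K, phi (p - (p@_m / q@_m) *: q) =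
      \sum_l (c l)%:MP *: phi (b l).
  move=> homq Nq in_q; have hom_pq : p - (p@_m / q@_m) *: q \is d.-homog.
    by rewrite rpredB // rpredZ.
  apply: IHk => //; first by rewrite raddfB /= phiZ rpredB // rpredZ.
  move=> m' m'_pq; rewrite (leq_trans (rk_lt m _ _ _)) //.
  - by have /dhomogP := hom_pq; apply.
  - exact: (initial_monomial_cancel in_m in_q m'_pq).
  - by case: in_m => /rk_p.
have [m_ms|[q [homq q0 in_q]]] := pre_ms _ _ homp Np in_m.
  have [homB NB in_B] := BP _ m_ms; have [c cE] := reduce _ homB NB in_B.
  have lt_i : (index m ms < size ms)%N by rewrite index_mem.
  pose i := Ordinal lt_i.
  have bi : b i = B m by rewrite /b (tnth_nth m) /= nth_index.
  (* Adding back the subtracted multiple of [B m] changes only the coordinate [i]. *)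
  exists (fun l => c l + (p@_m / (B m)@_m) *+ (l == i)).
  under eq_bigr do rewrite mpolyCD scalerDl.
  rewrite big_split /= -cE (bigD1 i) //= eqxx.
  rewrite big1 => [|l /negbTE->]; last by rewrite mpolyC0 scale0r.
  by rewrite addr0 mulr1n bi -phiZ -raddfD /= subrK.
(* Here [q] lies in the kernel, so the remainder has the same image as [p]. *)
have [|c cE] := reduce _ homq _ in_q; first by rewrite q0 rpred0.
by exists c; rewrite -cE raddfB /= phiZ q0 scaler0 subr0.
Qed.

End Dimension.

(** * The quotient of R/I by the first variables of the sequence *)

Section Quotients.
Variables (K : fieldType) (n : nat).
Local Notation R := {mpoly K[n]}.
Implicit Types (p q f : R) (m : 'X_{1..n}) (I : ideal R) (i : 'I_n).

Definition later_submod I i : submodule (R^o /m I) :=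
  @init_submod K n (R^o /m I) (revvars K n) i.

(** The iterated quotient is treated as a single linear image of R with kernel J, so that colons and
    dimensions can be computed on polynomials. *)
Definition double_pi I i (p : R^o) : (R^o /m I) /m later_submod I i :=
  \pi_((R^o /m I) /m later_submod I i) (\pi_(R^o /m I) p).

Fact double_pi_linear I i : linear (double_pi I i).
Proof. by move=> a p q; rewrite /double_pi !pi_quotmodD !pi_quotmodZ. Qed.

HB.instance Definition _ I i :=
  GRing.isLinear.Build R R^o _ *:%R (double_pi I i) (double_pi_linear I i).

Lemma alpha_quotE I i (j : int) : alpha_quot I i j =
  dimK ([set v | v \in annih _ ('X_(rev_ord i) : R)] `&`
        double_pi I i @` std_grading j).
Proof.
rewrite /alpha_quot /alpha /annih_mod tnth_mktuple; congr (dimK (_ `&` _)).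
apply/seteqP; split=> v.
  by case=> _ [p jp ->] ->; exists p.
by case=> p jp <-; exists (\pi_(R^o /m I) p) => //; exists p.
Qed.

Lemma rev_ord_lt (k l : 'I_n) : (k < l)%N -> (rev_ord l < rev_ord k)%N.
Proof. by move=> kl; rewrite /= ltn_sub2l ?ltnS // (leq_ltn_trans kl). Qed.

Lemma pi_quotmod0 (V : lmodType R) (N : submodule V) : \pi_(V /m N) 0 = 0.
Proof. by rewrite !piE. Qed.

Lemma pi_quotmod_eq0 (V : lmodType R) (N : submodule V) (v : V) :
  (\pi_(V /m N) v == 0) = (v \in N).
Proof. by rewrite -pi_quotmod0 pi_quotmodE subr0. Qed.

Lemma span_mem (V : lmodType R) (S : set V) v : S v -> v \in Defs.span S.
Proof.
move=> Sv; apply/asboolP; exists [:: (1, v)]; rewrite big_seq1 scale1r.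
by split=> // p; rewrite mem_seq1 => /eqP ->.
Qed.

(** Membership in the monomial ideal generated by the first [i] entries of [revvars], read off the
    support. *)
Definition later_vars i p :=
  {in msupp p, forall m, has_later_var (rev_ord i) m}.

Lemma later_varsD i p q :
  later_vars i p -> later_vars i q -> later_vars i (p + q).
Proof.
by move=> ip iq m /msuppD_le; rewrite mem_cat => /orP[/ip|/iq].
Qed.

Lemma later_varsM i p q : later_vars i p -> later_vars i (q * p).
Proof.
move=> ip m /msuppM_le/allpairsP[[m1 m2] /= [_ /ip + ->]].
by rewrite addmC; apply: has_later_varDl.
Qed.

(** This identifies the kernel with J. A combination of multiples of the later variables in R/I
    lifts to a polynomial [w] of that kind, and [f = p - w] lies in I; conversely every term of
    [p - f] is a multiple of a later variable. *)
Lemma double_pi_eq0 I i p :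
  double_pi I i p = 0 <-> exists2 f, f \in I & later_vars i (p - f).
Proof.
split=> [/eqP|[f If fp]].
  rewrite pi_quotmod_eq0 => /asboolP[s [sP pE]].
  have {pE sP}[w iw wE] : exists2 w : R,
      later_vars i w & \pi_(R^o /m I) p = \pi_(R^o /m I) w.
    rewrite {}pE; elim: s sP => [|[a v] s IHs] sP.
      by exists 0; [move=> m; rewrite msupp0 | rewrite big_nil !piE].
    have [|w iw wE] := IHs.
      by move=> u us; apply: sP; rewrite inE us orbT.
    have /= [k ki [u vE]] := sP _ (mem_head _ _).
    elim/(@quotW _ (R^o /m I)): u vE => x ->.
    exists (a * ('X_(rev_ord k) * x) + w).
      apply: later_varsD => //; rewrite mulrA mulrC mulrA; apply: later_varsM.
      move=> m; rewrite msuppX mem_seq1 => /eqP ->.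
      apply/has_later_varP; exists (rev_ord k); last by rewrite mnm1E eqxx.
      exact: rev_ord_lt.
    by rewrite big_cons /= wE pi_quotmodD !pi_quotmodZ tnth_mktuple.
  exists (p - w); last by rewrite opprB addrC subrK.
  by rewrite -(pi_quotmodE I) wE.
apply/eqP; rewrite pi_quotmod_eq0.
have -> : \pi_(R^o /m I) p = \pi_(R^o /m I) (p - f).
  by apply/eqP; rewrite pi_quotmodE opprB addrC subrK.
rewrite (mpolyE (p - f)); move: fp; rewrite /later_vars.
elim: (msupp _) => [|m s IHs] sP.
  by rewrite big_nil pi_quotmod0 rpred0.
rewrite big_cons pi_quotmodD rpredD //; last first.
  by apply: IHs => m' m's; apply: sP; rewrite inE m's orbT.
have /has_later_varP[l il ml] := sP _ (mem_head _ _).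
(* Factoring out the later variable ['X_l] exhibits the term as a generator of the span. *)
have -> : (p - f)@_m *: 'X_[m] = 'X_l * ((p - f)@_m *: 'X_[m - U_(l)]) :> R.
  by rewrite -scalerAr -mpolyXD addmC submK // lep1mP -lt0n.
rewrite -[_ * _]/('X_l *: (_ : R^o)) pi_quotmodZ; apply: span_mem.
exists (rev_ord l); first by rewrite -(rev_ordK i); exact: rev_ord_lt.
by eexists; rewrite tnth_mktuple rev_ordK.
Qed.

(** * Initial monomials of J and of J : x_r *)

Definition initial_of I m := exists2 p : R, p \in I & initial_monomial p m.

(** The initial monomials of elements of I are stable under multiplication by monomials, so their
    K-span is already the ideal they generate. *)
Lemma initial_idealP I f :
  f \in initial_ideal I <-> {in msupp f, forall m, initial_of I m}.
Proof.
split=> [/asboolP[s [sP ->]] m|].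
  elim: s sP => [|[a v] s IHs] sP; first by rewrite big_nil msupp0.
  rewrite big_cons => /msuppD_le; rewrite mem_cat => /orP[|]; last first.
    by apply: IHs => u us; apply: sP; rewrite inE us orbT.
  have /= [m0 [p Ip in_p] <-] := sP _ (mem_head _ _).
  move=> /msuppM_le/allpairsP[[m1 m2] /= [_]].
  rewrite msuppX mem_seq1 => /eqP -> ->.
  exists (p * 'X_[m1]); last exact: initial_monomialMX.
  by rewrite mulrC; apply: (rpredZ ('X_[m1] : R) Ip).
rewrite [X in _ -> X \in _]mpolyE; elim: (msupp f) => [|m s IHs] sP.
  by rewrite big_nil; apply: (rpred0 (initial_ideal I)).
rewrite big_cons; apply: (rpredD (S := initial_ideal I)); last first.
  by apply: IHs => m' m's; apply: sP; rewrite inE m's orbT.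
rewrite -mul_mpolyC; apply: (@rpredZ _ R^o (initial_ideal I)).
by apply: span_mem; exists m => //; apply: sP; rewrite mem_head.
Qed.

(* Membership of the monomial m in in(I) + (x_n, ..., x_(n-i+1)). *)
Definition initial_of_add I i m :=
  has_later_var (rev_ord i) m \/ initial_of I m.

(** The kernel is a sum of two monomial ideals, hence membership is decided term by term. *)
Lemma double_pi_initial I i p : double_pi (initial_ideal I) i p = 0 <->
  {in msupp p, forall m, initial_of_add I i m}.
Proof.
rewrite double_pi_eq0; split=> [[f /initial_idealP inf fp] m mp|].
  have [mf|mNf] := boolP (m \in msupp f); [right; exact: inf | left; apply: fp].
  by rewrite mcoeff_msupp mcoeffB (memN_msupp_eq0 mNf) subr0 -mcoeff_msupp.
move=> inp.
(* The terms of [p] without later variables must come from in(I). *)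
pose f := \sum_(m <- msupp p | ~~ has_later_var (rev_ord i) m) p@_m *: 'X_[m].
exists f.
  rewrite /f big_seq_cond; apply: (rpred_sum (S := initial_ideal I)) => m.
  case/andP=> /inp[-> //|in_m _].
  apply/initial_idealP => m' /msuppZ_le.
  by rewrite msuppX mem_seq1 => /eqP ->.
rewrite {1}(mpolyE p) (bigID (fun m => ~~ has_later_var (rev_ord i) m)) /=.
rewrite addrC addrK.
move=> m /msupp_sum_le/flattenP[s /mapP[m']].
rewrite mem_filter negbK => /andP[m'_i _] -> /msuppZ_le.
by rewrite msuppX mem_seq1 => /eqP ->.
Qed.

(** The inclusion of in(J) in in(I) + (x_n, ..., x_(r+1)): [p] and [f] agree on monomials without
    later variables, and in the degree of [m] the monomials with later variables are below [m]. *)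
Lemma double_pi_initial_monomial I i p m : homogeneous_ideal I ->
  double_pi I i p = 0 -> initial_monomial p m -> initial_of_add I i m.
Proof.
move=> homI /double_pi_eq0[f If fp] [mp max_m].
have [m_i|m_i] := boolP (has_later_var (rev_ord i) m); first by left.
have supE m' : ~~ has_later_var (rev_ord i) m' ->
    (m' \in msupp f) = (m' \in msupp p).
  move=> m'_i; have : m' \notin msupp (p - f) by apply: contra m'_i => /fp.
  by rewrite !mcoeff_msupp negbK mcoeffB subr_eq0 => /eqP ->.
(* Passing to a component is necessary because [f] may have terms of higher degree in the later
   variables. *)
right; exists (pihomog mdeg (mdeg m) f); first exact: homI.
split=> [|m'].
  by rewrite mcoeff_msupp mcoeff_pihomog eqxx -mcoeff_msupp supE.
move=> m'_f neq.
have deg_m' : mdeg m' = mdeg m.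
  by have /dhomogP := pihomogP mdeg (mdeg m) f; apply.
have m'f : m' \in msupp f.
  by move: m'_f; rewrite !mcoeff_msupp mcoeff_pihomog deg_m' eqxx.
have [m'_i|m'_i] := boolP (has_later_var (rev_ord i) m').
  exact: (later_var_revlex_lt (r := rev_ord i)).
by apply: max_m => //; rewrite -supE.
Qed.

Lemma initial_of_homog I m : homogeneous_ideal I -> initial_of I m ->
  exists p : R, [/\ p \is (mdeg m).-homog, p \in I & initial_monomial p m].
Proof.
move=> homI [p Ip in_p]; exists (pihomog mdeg (mdeg m) p).
by split; [exact: pihomogP | exact: homI | exact: initial_monomial_pihomog].
Qed.

Lemma ideal_double_pi I i p : p \in I -> double_pi I i p = 0.
Proof.
move=> Ip; apply/double_pi_eq0.
by exists p; rewrite // subrr => m; rewrite msupp0.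
Qed.

Lemma later_vars_double_pi I i p : later_vars i p -> double_pi I i p = 0.
Proof.
move=> ip; apply/double_pi_eq0.
by exists 0; rewrite ?subr0 //; exact: (rpred0 I).
Qed.

Lemma later_varsX i m :
  has_later_var (rev_ord i) m -> later_vars i ('X_[m] : R).
Proof. by move=> im m'; rewrite msuppX mem_seq1 => /eqP ->. Qed.

(** The reverse inclusion: a monomial with a later variable is itself in J, and any other comes from
    a homogeneous element of I. *)
Lemma initial_of_addP I i m : homogeneous_ideal I -> initial_of_add I i m ->
  exists p : R,
    [/\ p \is (mdeg m).-homog, double_pi I i p = 0 & initial_monomial p m].
Proof.
move=> homI [m_i|/(initial_of_homog homI)[p [homp Ip in_p]]].
  exists 'X_[m]; split; [by rewrite dhomogX| |exact: initial_monomialX].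
  exact/later_vars_double_pi/later_varsX.
by exists p; split=> //; exact: ideal_double_pi.
Qed.

(* A monomial in x_1, ..., x_r below x_r m in the reverse lexicographic order
   is divisible by x_r; this gives in(J : x_r) = in(J) : x_r. *)
Lemma initial_of_add_colon I i m : homogeneous_ideal I ->
  initial_of_add I i (U_(rev_ord i) + m)%MM ->
  exists p : R,
    [/\ p \is (mdeg m).-homog, double_pi I i ('X_(rev_ord i) * p) = 0
      & initial_monomial p m].
Proof.
set r := rev_ord i => homI; have [m_i _|m_i] := boolP (has_later_var r m).
  exists 'X_[m]; split; [by rewrite dhomogX| |exact: initial_monomialX].
  exact/later_vars_double_pi/later_varsM/later_varsX.
case; first by rewrite has_later_varD1 (negbTE m_i).
move=> /(initial_of_homog homI)[f [/dhomogP homf If [mf max_m]]].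
(* The part of [f] without later variables, divided by x_r; [le_var] shows that the division is
   exact. *)
pose q := \sum_(k <- msupp f | ~~ has_later_var r k) f@_k *: 'X_[k - U_(r)] : R.
have le_var k : k \in msupp f -> ~~ has_later_var r k -> (U_(r) <= k)%MM.
  move=> kf k_i; rewrite lep1mP -lt0n; have [->|neq] := eqVneq k (U_(r) + m)%MM.
    by rewrite mnmDE mnm1E eqxx.
  apply: leq_trans (revlex_le_var (homf _ kf) k_i _ (max_m _ kf neq)).
    by rewrite mnmDE mnm1E eqxx.
  by rewrite has_later_varD1.
have qE : 'X_r * q = \sum_(k <- msupp f | ~~ has_later_var r k) f@_k *: 'X_[k].
  rewrite mulr_sumr big_seq_cond [RHS]big_seq_cond.
  apply: eq_bigr => k /andP[kf k_i].
  by rewrite -scalerAr -mpolyXD addmC submK // le_var.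
have q_coef k : q@_k = if has_later_var r k then 0 else f@_(U_(r) + k)%MM.
  rewrite -(mcoeffMX q U_(r)) mulrC qE raddf_sum /= -has_later_varD1.
  have [k_i|k_i] := boolP (has_later_var _ _).
    rewrite big1 // => k' k'_i; rewrite mcoeffZ mcoeffX.
    by rewrite (negbTE (_ : k' != _)) ?mulr0 //; apply: contraNneq k'_i => ->.
  rewrite [in RHS](mpolyE f) raddf_sum big_mkcond; apply: eq_bigr => k' _ /=.
  case: ifPn => // k'_i.
  rewrite mcoeffZ mcoeffX (negbTE (_ : k' != _)) ?mulr0 //.
  by apply: contraNneq k_i => <-; rewrite negbK in k'_i.
have q_supp k : k \in msupp q -> (U_(r) + k)%MM \in msupp f.
  by rewrite !mcoeff_msupp q_coef; case: ifP; rewrite ?eqxx.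
exists q; split.
- by apply/dhomogP => k /q_supp /homf; rewrite /= !mdegD => /addnI.
(* The product ['X_r * q] differs from [f] only in terms with later variables. *)
- apply/double_pi_eq0; exists f => //; rewrite qE [X in _ - X]mpolyE.
  rewrite [X in _ - X](bigID (fun k => ~~ has_later_var r k)) /= opprD addNKr.
  move=> k; rewrite (perm_mem (msuppN _)).
  move=> /msupp_sum_le/flattenP[s /mapP[k']].
  rewrite mem_filter negbK => /andP[k'_i _] -> /msuppZ_le.
  by rewrite msuppX mem_seq1 => /eqP ->.
split=> [|k kq neq].
  by rewrite mcoeff_msupp q_coef (negbTE m_i) -mcoeff_msupp.
rewrite -(revlex_lt_add2l U_(r)); apply: max_m; first exact: q_supp.
by apply: contra neq => /eqP/addmI ->.
Qed.

End Quotients.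

(** * Annihilator numbers as counts of monomials *)

Section AnnihilatorNumbers.
Variables (K : fieldType) (n : nat).
Local Notation R := {mpoly K[n]}.
Implicit Types (p : R) (m : 'X_{1..n}) (I : ideal R) (i : 'I_n).

Lemma in_annih (V : lmodType R) (a : R) (v : V) :
  (v \in annih V a) = (a *: v == 0).
Proof. by []. Qed.

Lemma double_pi_annih I i (a : R) p :
  double_pi I i p \in annih _ a <-> double_pi I i (a * p) = 0.
Proof.
rewrite in_annih /double_pi -[a * p]/(a *: (p : R^o)) !pi_quotmodZ.
by split=> /eqP.
Qed.

(** With [T] standing for in(J), the monomials of degree [d] in in(J) : x_r outside in(J), filtered
    from the finite type of monomials of degree at most [d]. *)
Definition colon_monomials (T : 'X_{1..n} -> Prop) (r : 'I_n) (d : nat) :=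

  [seq m <- [seq val x | x <- enum {: 'X_{1..n < d.+1}}] |
     [&& mdeg m == d, `[< T (U_(r) + m)%MM >] & ~~ `[< T m >]]].

(** The hypotheses make [T] the set of initial monomials of J and realise each monomial of [T] : x_r
    as an initial monomial of J : x_r. The count depends on [T] alone, so two ideals sharing [T]
    have equal annihilator numbers. *)
Lemma alpha_quot_initial I i d (T : 'X_{1..n} -> Prop) :
  (forall p m, double_pi I i p = 0 -> initial_monomial p m -> T m) ->
  (forall m, T m -> exists p,
     [/\ p \is (mdeg m).-homog, double_pi I i p = 0 & initial_monomial p m]) ->
  (forall m, T (U_(rev_ord i) + m)%MM -> exists p,
     [/\ p \is (mdeg m).-homog, double_pi I i ('X_(rev_ord i) * p) = 0
       & initial_monomial p m]) ->
  alpha_quot I i (Posz d) = size (colon_monomials T (rev_ord i) d).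
Proof.
set r := rev_ord i => inT Tin Tcolon; rewrite alpha_quotE; apply: dimKE.
apply: has_dim_initial.
- by rewrite filter_uniq // (map_inj_uniq val_inj) enum_uniq.
- move=> p m _ p0 in_m; rewrite mem_filter; apply/negP => /andP[/and3P[_ _]].
  by move/asboolPn; case; apply: inT p0 in_m.
- move=> p m homp /double_pi_annih xp0 in_m.
  have deg_m : mdeg m = d by case: in_m => mp _; have /dhomogP := homp; apply.
  have [Tm|nTm] := pselect (T m); first by right; rewrite -deg_m; exact: Tin.
  left; have lt_m : (mdeg m < d.+1)%N by rewrite deg_m.
  rewrite mem_filter deg_m eqxx /=; apply/andP; split; last first.
    by apply/mapP; exists (BMultinom lt_m); rewrite ?mem_enum.
  apply/andP; split; last exact/asboolPn.
  (* The initial monomial of ['X_r * p] is x_r times that of [p]. *)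
  apply/asboolP/(inT _ _ xp0).
  by rewrite mulrC; exact: initial_monomialMX.
- move=> m; rewrite mem_filter => /andP[/and3P[/eqP <- /asboolP/Tcolon + _] _].
  by case=> p [homp xp0 in_m]; exists p; split=> //; exact/double_pi_annih.
Qed.

Lemma alpha_quot_neg I i k : alpha_quot I i (Negz k) = 0%N.
Proof.
rewrite alpha_quotE; apply: dimKE; exists (fun=> 0); split=> [[]//|c _ []//|v].
by case=> _ [p -> <-]; exists (fun=> 0); rewrite big_ord0 raddf0.
Qed.

End AnnihilatorNumbers.

Theorem corollary3p2 (K : fieldType) (n : nat) (I : ideal {mpoly K[n]}) :
  infinite_set [set: K] ->
  homogeneous_ideal I ->
  (forall i : 'I_n, finite_length (a_mod I i)) ->
  forall (i : 'I_n) (j : int),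
    alpha_quot I i j = alpha_quot (initial_ideal I) i j.
Proof.
move=> _ homI _ i [d|k]; last by rewrite !alpha_quot_neg.
(* The same set of monomials serves for I and for in(I). *)
rewrite (@alpha_quot_initial _ _ _ _ _ (initial_of_add I i)).
- apply/esym/alpha_quot_initial
    => [p m /double_pi_initial inp [/inp]//|m Tm|m Tm].
    (* For in(I) the kernel is a monomial ideal, so the monomials themselves are the required
       polynomials. *)
    exists 'X_[m]; split; [by rewrite dhomogX | | exact: initial_monomialX].
    by apply/double_pi_initial => k; rewrite msuppX mem_seq1 => /eqP ->.
  exists 'X_[m]; split; [by rewrite dhomogX | | exact: initial_monomialX].
  apply/double_pi_initial => k; rewrite -mpolyXD msuppX mem_seq1 => /eqP ->.
  exact: Tm.
- by move=> p m; exact: double_pi_initial_monomial.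
- by move=> m; exact: initial_of_addP.
- by move=> m; exact: initial_of_add_colon.
Qed.
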